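(* Let $f$ and $\mathcal{A}\in\mathbb{C}^{n\times n\times p}$ be such that the Fréchet derivative $L_f(\mathcal{A},\cdot)$ of the tensor t-function $f$ exists, and denote $$\|L_f(\mathcal{A})\|:=\max_{\mathcal{C}\neq 0}\frac{\|L_f(\mathcal{A},\mathcal{C})\|}{\|\mathcal{C}\|}.$$ Then the absolute and relative condition numbers of $f(\mathcal{A})$ are given by $$\mathrm{cond}_{\mathrm{abs}}(f,\mathcal{A})=\|L_f(\mathcal{A})\|,\qquad \mathrm{cond}_{\mathrm{rel}}(f,\mathcal{A})=\frac{\|L_f(\mathcal{A})\|\,\|\mathcal{A}\|}{\|f(\mathcal{A})\|}.$$
   Context: For a tensor $\mathcal{A}\in\mathbb{C}^{n\times n\times p}$ with frontal slices $A^{(1)},\dots,A^{(p)}$, $\mathrm{unfold}(\mathcal{A})\in\mathbb{C}^{np\times n}$ is the block column with blocks $A^{(1)},\dots,A^{(p)}$, $\mathrm{fold}$ is its inverse, and $\mathrm{bcirc}(\mathcal{A})\in\mathbb{C}^{np\times np}$ is the block circulant matrix with first block column $\mathrm{unfold}(\mathcal{A})$. The t-function is $f(\mathcal{A}):=\mathrm{fold}(f(\mathrm{bcirc}(\mathcal{A}))\boldsymbol{E}_1)$, with $\boldsymbol{E}_1=\boldsymbol{e}_1\otimes I_n\in\mathbb{C}^{np\times n}$ and $f(\mathrm{bcirc}(\mathcal{A}))$ the usual matrix function. The norm is $\|\mathcal{A}\|=\big(\sum_{i,j,k}|\mathcal{A}(i,j,k)|^2\big)^{1/2}$. $L_f(\mathcal{A},\cdot)$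 is the linear map with $f(\mathcal{A}+\mathcal{C})-f(\mathcal{A})=L_f(\mathcal{A},\mathcal{C})+o(\|\mathcal{C}\|)$. The condition numbers are defined by $$\mathrm{cond}_{\mathrm{abs}}(f,\mathcal{A}):=\lim_{\varepsilon\to0}\ \sup_{\|\mathcal{C}\|\le\varepsilon}\frac{\|f(\mathcal{A}+\mathcal{C})-f(\mathcal{A})\|}{\varepsilon},\qquad \mathrm{cond}_{\mathrm{rel}}(f,\mathcal{A}):=\lim_{\varepsilon\to0}\ \sup_{\|\mathcal{C}\|\le\varepsilon\|\mathcal{A}\|}\frac{\|f(\mathcal{A}+\mathcal{C})-f(\mathcal{A})\|}{\varepsilon\|f(\mathcal{A})\|},$$ with $\varepsilon>0$, the relative one being considered when $f(\mathcal{A})\neq0$. *)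

(* Defs.v *)
From mathcomp Require Import all_boot all_order all_algebra.
From mathcomp Require Import complex mxtens.
From mathcomp Require Import all_classical all_reals all_analysis.

Set Implicit Arguments.
Unset Strict Implicit.
Unset Printing Implicit Defensive.

Import Order.TTheory GRing.Theory Num.Theory.
Import numFieldNormedType.Exports.
Local Open Scope classical_set_scope.
Local Open Scope ring_scope.
Local Open Scope complex_scope.

(* A tensor in C^{n x n x p} is the family of its p frontal slices, indexed
   from 0; addition and scaling are those of finite functions. *)
Notation tensor R n p := {ffun 'I_p -> 'M[R[i]]_n}.

Section MatrixFunction.
Variable R : realType.

(* f, a partial function with domain D, is k times complex differentiable
   at z. [derive1n] is total, hence the explicit requirement that each
   lower-order derivative exists in a neighbourhood of z. *)
Fixpoint has_derivs (D : set R[i]) (f : R[i] -> R[i]) (k : nat) (z : R[i]) :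
    Prop :=
  if k is k'.+1 then
    (\forall w \near (z : R[i]^o), has_derivs D f k' w) /\
    derivable (derive1n k' (f : R[i]^o -> R[i]^o)) z 1
  else D z.

(* The index of the eigenvalue z of M (the size of its largest Jordan block)
   is [mup z (mxminpoly M)]. *)
Definition defined_on_spectrum (D : set R[i]) (f : R[i] -> R[i]) (m : nat)
    (M : 'M[R[i]]_m.+1) : Prop :=
  forall z, eigenvalue M z -> has_derivs D f (mup z (mxminpoly M)).-1 z.

Definition hermite_interpolant (f : R[i] -> R[i]) (m : nat)
    (M : 'M[R[i]]_m.+1) (q : {poly R[i]}) : Prop :=
  (size q < size (mxminpoly M))%N /\
  forall z, eigenvalue M z -> forall j, (j < mup z (mxminpoly M))%N ->
    (q^`(j)).[z] = derive1n j (f : R[i]^o -> R[i]^o) z.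

(* The (primary) matrix function f(M) := q(M), for q the unique polynomial of
   degree less than that of the minimal polynomial of M interpolating f, in
   the sense of Hermite, on the spectrum of M. It is the intended value when f
   is defined on the spectrum of M. *)
Definition matfun (f : R[i] -> R[i]) (m : nat) (M : 'M[R[i]]_m.+1) :
    'M[R[i]]_m.+1 :=
  horner_mx M (xget 0 [set q | hermite_interpolant f M q]).

End MatrixFunction.

Section Tensors.
Variables (R : realType) (n p : nat).

(* Row (k, i) of a block column is entry i of block k:
   [mxtens_index (k, i)] has value k * n + i. *)
Definition unfold (A : tensor R n p) : 'M[R[i]]_(p * n, n) :=
  \matrix_(r, j) A (mxtens_unindex r).1 (mxtens_unindex r).2 j.

Definition fold (X : 'M[R[i]]_(p * n, n)) : tensor R n p :=
  [ffun k => \matrix_(i, j) X (mxtens_index (k, i)) j].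

Lemma unfoldK : cancel unfold fold.
Proof.
move=> A; apply/ffunP => k; apply/matrixP => i j.
by rewrite ffunE !mxE mxtens_indexK.
Qed.

Lemma foldK : cancel fold unfold.
Proof.
move=> X; apply/matrixP => r j.
by rewrite mxE ffunE mxE -surjective_pairing mxtens_unindexK.
Qed.

Definition tnorm (A : tensor R n p) : R :=
  Num.sqrt (\sum_(i < n) \sum_(j < n) \sum_(k < p) Normc.normc (A k i j) ^+ 2).

End Tensors.

Section TFunction.
Variables (R : realType) (n p : nat).
Implicit Types (A C : tensor R n.+1 p.+1) (f : R[i] -> R[i]).

(* Block (k, l) is the slice of index k - l modulo p.+1, the subtraction
   being that of the group 'I_p.+1. *)
Definition bcirc A : 'M[R[i]]_(p.+1 * n.+1) :=
  \matrix_(r, s) A ((mxtens_unindex r).1 - (mxtens_unindex s).1)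
                   (mxtens_unindex r).2 (mxtens_unindex s).2.

(* e_1 (x) I, of width 1 * n.+1 before the cast. *)
Definition E1 : 'M[R[i]]_(p.+1 * n.+1, n.+1) :=
  castmx (erefl, mul1n n.+1)
    ((delta_mx 0 0 : 'cV[R[i]]_p.+1) *t (1%:M : 'M[R[i]]_n.+1)).

Lemma bcirc_E1 A : bcirc A *m E1 = unfold A.
Proof.
have c1 (j : 'I_n.+1) : (mxtens_unindex (cast_ord (esym (mul1n n.+1)) j)).1 = 0.
  by apply: val_inj => /=; rewrite divn_small.
have c2 (j : 'I_n.+1) : (mxtens_unindex (cast_ord (esym (mul1n n.+1)) j)).2 = j.
  by apply: val_inj => /=; rewrite modn_small.
apply/matrixP => r j; rewrite mxE (bigD1 (mxtens_index (0, j))) //= big1.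
  rewrite addr0 castmxE cast_ord_id !mxE c1 c2 mxtens_indexK /= subr0.
  by rewrite !eqxx !mulr1.
move=> s; case: (mxtens_indexP s) => k i ne.
rewrite castmxE cast_ord_id !mxE c1 c2 mxtens_indexK /= andbT.
have [k0|_] := eqVneq k 0; last by rewrite mul0r mulr0.
have [ij|_] := eqVneq i j; last by rewrite mulr0 mulr0.
by rewrite k0 ij eqxx in ne.
Qed.

Definition tfun f A : tensor R n.+1 p.+1 :=
  fold ((matfun f (bcirc A) : 'M[R[i]]_(p.+1 * n.+1)) *m E1).

Definition tfun_defined (D : set R[i]) f A : Prop :=
  defined_on_spectrum D f (bcirc A).

(* L = L_f(A, .); in particular f must be defined at all tensors near A. *)
Definition is_frechet (D : set R[i]) f A
    (L : {linear tensor R n.+1 p.+1 -> tensor R n.+1 p.+1}) : Prop :=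
  (exists2 d : R, 0 < d & forall C, tnorm C <= d -> tfun_defined D f (A + C)) /\
  (forall e : R, 0 < e -> exists2 d : R, 0 < d & forall C, tnorm C <= d ->
     tnorm (tfun f (A + C) - tfun f A - L C) <= e * tnorm C).

Definition gains (L : tensor R n.+1 p.+1 -> tensor R n.+1 p.+1) : set R :=
  [set tnorm (L C) / tnorm C | C in [set C | C != 0]].

Definition opnorm (L : tensor R n.+1 p.+1 -> tensor R n.+1 p.+1) : R :=
  sup (gains L).

Definition abs_quotient f A (e : R) : \bar R :=
  ereal_sup [set (tnorm (tfun f (A + C) - tfun f A) / e)%:E
            | C in [set C | tnorm C <= e]].

Definition rel_quotient f A (e : R) : \bar R :=
  ereal_sup [set (tnorm (tfun f (A + C) - tfun f A) / (e * tnorm (tfun f A)))%:E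
            | C in [set C | tnorm C <= e * tnorm A]].

Definition cond_abs f A : \bar R := lim (abs_quotient f A e @[e --> 0^'+]).

Definition cond_rel f A : \bar R := lim (rel_quotient f A e @[e --> 0^'+]).

End TFunction.

(* Main.v *)
Require Import Defs.
From mathcomp Require Import all_boot all_order all_algebra.
From mathcomp Require Import complex.
From mathcomp Require Import all_classical all_reals all_analysis.
From mathcomp Require Import ring lra.

Set Implicit Arguments.
Unset Strict Implicit.
Unset Printing Implicit Defensive.

Import Order.TTheory GRing.Theory Num.Theory.
Import numFieldNormedType.Exports.
Local Open Scope classical_set_scope.
Local Open Scope ring_scope.
Local Open Scope complex_scope.

(** Both condition numbers are limits, as [e] tends to [0] from the right, of the
    supremum of [tnorm (G C) / (e * d)] over the ball [tnorm C <= e * s], where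
    [G C = f(A + C) - f(A)] is [L C + o(C)]: the absolute one for [s = d = 1],
    the relative one for [s = tnorm A] and [d = tnorm (tfun f A)].

    The supremum of the gains of [L] is attained ([opnorm_max]): the tensors
    form a real vector space of finite dimension, so, in real coordinates, both
    [tnorm (L C)] and [tnorm C] become seminorms on row vectors, hence
    continuous, and their quotient, which does not change when [C] is scaled,
    has a maximum on the compact unit sphere of the sup norm
    ([seminorm_ratio_max]). That [tnorm] is a norm is Minkowski's inequality.

    Write [M] for [opnorm L]. Given [eta > 0], as soon as [e] is small enough,
    [tnorm (G C - L C) <= eta * tnorm C] on the whole ball
    [tnorm C <= e * s]. There [tnorm (G C) <= (M + eta) * (e * s)]; and a
    maximizer of the gain, rescaled to have norm exactly [e * s], satisfies
    [tnorm (G C) >= (M - eta) * (e * s)]. After division by [e * d] the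
    supremum over the ball lies within [eta * s / d] of [M * s / d], which
    is therefore the limit ([quotient_cvg]). *)

(** * Minkowski's inequality for finite sums *)

(** With [x] and [y] the two Euclidean norms, expand the inequality
    [0 <= \sum_i (y * a i - x * b i) ^+ 2] and divide by [2 * x * y]; if [x]
    or [y] vanishes, so does the corresponding family. *)
Lemma cauchy_schwarz_sum (R : realType) (I : finType) (a b : I -> R) :
  \sum_i a i * b i <=
    Num.sqrt (\sum_i a i ^+ 2) * Num.sqrt (\sum_i b i ^+ 2).
Proof.
set sa := \sum_i a i ^+ 2; set sb := \sum_i b i ^+ 2.
have sa0 : 0 <= sa by apply: sumr_ge0 => i _; exact: sqr_ge0.
have sb0 : 0 <= sb by apply: sumr_ge0 => i _; exact: sqr_ge0.
have null (c : I -> R) : \sum_i c i ^+ 2 = 0 -> forall i, c i = 0.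
  move=> c0 i; have := @psumr_eq0P _ I xpredT _ (fun j _ => sqr_ge0 (c j)) c0 i isT.
  by move=> /eqP; rewrite sqrf_eq0 => /eqP.
set x := Num.sqrt sa; set y := Num.sqrt sb.
have x2 : x ^+ 2 = sa by rewrite sqr_sqrtr.
have y2 : y ^+ 2 = sb by rewrite sqr_sqrtr.
have [x0|x0] := eqVneq x 0.
  rewrite x0 mul0r big1// => i _; rewrite (null a) ?mul0r//.
  by rewrite -/sa -x2 x0 expr0n.
have [y0|y0] := eqVneq y 0.
  rewrite y0 mulr0 big1// => i _; rewrite (null b) ?mulr0//.
  by rewrite -/sb -y2 y0 expr0n.
have xy : 0 < x * y by rewrite mulr_gt0// lt0r ?x0 ?y0 sqrtr_ge0.
have : 0 <= \sum_i (y * a i - x * b i) ^+ 2.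
  by apply: sumr_ge0 => i _; exact: sqr_ge0.
have -> : \sum_i (y * a i - x * b i) ^+ 2 =
    2 * (x * y) * (x * y - \sum_i a i * b i).
  transitivity (\sum_i (y ^+ 2 * a i ^+ 2 + x ^+ 2 * b i ^+ 2 -
                        2 * (x * y) * (a i * b i))).
    by apply: eq_bigr => i _; ring.
  rewrite !big_split/= sumrN -!mulr_sumr -/sa -/sb -x2 -y2; ring.
by rewrite pmulr_rge0 ?subr_ge0// mulr_gt0.
Qed.

Lemma minkowski_sum (R : realType) (I : finType) (a b : I -> R) :
  Num.sqrt (\sum_i (a i + b i) ^+ 2) <=
    Num.sqrt (\sum_i a i ^+ 2) + Num.sqrt (\sum_i b i ^+ 2).
Proof.
have S0 (c : I -> R) : 0 <= \sum_i c i ^+ 2.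
  by apply: sumr_ge0 => i _; exact: sqr_ge0.
rewrite -(@ler_pXn2r _ 2) ?nnegrE ?addr_ge0 ?sqrtr_ge0//.
rewrite sqr_sqrtr// sqrrD !sqr_sqrtr//.
under eq_bigr do rewrite sqrrD.
rewrite !big_split/= lerD2r lerD2l -mulr2n lerMn2r/=.
exact: cauchy_schwarz_sum.
Qed.

(** * The Frobenius norm of tensors is a norm *)

Section TensorNorm.
Variables (R : realType) (n p : nat).
Implicit Types (A B C : tensor R n p).

Lemma tnormE C : tnorm C =
  Num.sqrt (\sum_(x : 'I_n * ('I_n * 'I_p)) Normc.normc (C x.2.2 x.1 x.2.1) ^+ 2).
Proof.
rewrite /tnorm; under eq_bigr do rewrite pair_big/=.
by rewrite pair_big.
Qed.

Lemma tnorm_ge0 C : 0 <= tnorm C. Proof. exact: sqrtr_ge0. Qed.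

Lemma normc_ge0 (z : R[i]) : 0 <= Normc.normc z.
Proof. by case: z => a b; exact: sqrtr_ge0. Qed.

Lemma tnormD A B : tnorm (A + B) <= tnorm A + tnorm B.
Proof.
rewrite !tnormE; apply: le_trans (minkowski_sum _ _).
apply: ler_wsqrtr; apply: ler_sum => x _.
rewrite ler_pXn2r ?nnegrE ?addr_ge0 ?normc_ge0//.
by rewrite ffunE mxE; exact: le_normcD.
Qed.

Lemma tnormZ (a : R) C : tnorm (a%:C *: C) = `|a| * tnorm C.
Proof.
rewrite !tnormE -sqrtr_sqr -sqrtrM ?sqr_ge0// mulr_sumr.
congr Num.sqrt; apply: eq_bigr => x _.
rewrite ffunE mxE Normc.normcM exprMn; congr (_ * _).
by rewrite /= expr0n addr0 sqr_sqrtr ?sqr_ge0.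
Qed.

Lemma tnorm_eq0 C : (tnorm C == 0) = (C == 0).
Proof.
apply/idP/idP => [|/eqP ->]; last first.
  by rewrite -(scale0r 0) (_ : 0 = 0%:C) // tnormZ normr0 mul0r.
rewrite tnormE sqrtr_eq0 => C0; apply/eqP/ffunP => k; apply/matrixP => i j.
rewrite ffunE mxE; apply: Normc.eq0_normc; apply/eqP; rewrite -sqrf_eq0.
have S0 : \sum_(x : 'I_n * ('I_n * 'I_p))
    Normc.normc (C x.2.2 x.1 x.2.1) ^+ 2 = 0.
  by apply/le_anti; rewrite C0 sumr_ge0// => x _; exact: sqr_ge0.
by have /= -> := @psumr_eq0P _ _ xpredT _ (fun x _ => sqr_ge0 _) S0 (i, (j, k)) isT.
Qed.

Lemma tnorm0 : tnorm (0 : tensor R n p) = 0.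
Proof. by apply/eqP; rewrite tnorm_eq0. Qed.

Lemma tnormN C : tnorm (- C) = tnorm C.
Proof.
by rewrite -scaleN1r (_ : -1 = (-1)%:C) ?tnormZ ?normrN1 ?mul1r// rmorphN1.
Qed.

Lemma tnorm_gt0 C : (0 < tnorm C) = (C != 0).
Proof. by rewrite lt0r tnorm_ge0 andbT tnorm_eq0. Qed.

End TensorNorm.

(** * Seminorms on real row vectors *)

Section Seminorms.
Variables (R : realType) (n : nat).

Definition seminorm (g : 'rV[R]_n -> R) :=
  (forall u v, g (u + v) <= g u + g v) /\ (forall a v, g (a *: v) = `|a| * g v).

Implicit Types g h : 'rV[R]_n -> R.

(** Expanding a vector in the standard basis gives [g v <= K * `|v|], where [K]
    is the sum of the values of [g] on the basis; the reverse triangle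
    inequality then makes [g] Lipschitz. *)
Lemma seminorm_continuous g : seminorm g -> continuous g.
Proof.
move=> [gD gZ].
have gN v : g (- v) = g v by rewrite -scaleN1r gZ normrN1 mul1r.
have g0 : g 0 = 0 by rewrite -(scale0r 0) gZ normr0 mul0r.
have g_ge0 v : 0 <= g v.
  by have := gD v (- v); rewrite subrr g0 gN -mulr2n pmulrn_lge0.
pose K := \sum_j g (delta_mx 0 j).
have K0 : 0 <= K by apply: sumr_ge0.
have gK v : g v <= K * `|v|.
  rewrite {1}(row_sum_delta v) /K mulr_suml.
  apply: (@le_trans _ _ (\sum_j g (v 0 j *: delta_mx 0 j))).
    by apply: (big_ind2 (fun u r => g u <= r)) => [|u a w b ua wb|//];
      rewrite ?g0// (le_trans (gD _ _))// lerD.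
  apply: ler_sum => j _; rewrite gZ mulrC ler_wpM2l//.
  rewrite [leRHS]/Num.Def.normr/= mx_normrE.
  by apply/bigmax_geP; right => /=; exists (0, j).
move=> u; apply/(@cvgrPdist_le _ _ _ (nbhs u) (nbhs_filter u)) => e e0.
(* K may be 0, hence K + 1. *)
have d0 : 0 < e / (K + 1) by rewrite divr_gt0// ltr_wpDl.
near=> v.
have uv : `|u - v| <= e / (K + 1).
  by near: v; exact: cvgr_dist_le.
have ler : `|g u - g v| <= g (u - v).
  have := gD (u - v) v; have := gD (v - u) u.
  rewrite !subrK -(gN (v - u)) opprB ler_norml; lra.
apply: le_trans ler _; apply: le_trans (gK _) _.
apply: le_trans (ler_wpM2l K0 uv) _.
rewrite mulrCA ler_piMr ?(ltW e0)// ler_pdivrMr ?mul1r ?lerDl ?ler01//.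
by rewrite ltr_wpDl.
Unshelve. all: by end_near. Qed.

(** The quotient is invariant under scaling, so a maximum on the unit sphere,
    which is compact, is a global one. The vector [v1] only excludes the zero
    space, whose unit sphere is empty. *)
Lemma seminorm_ratio_max g h (v1 : 'rV[R]_n) :
  seminorm g -> seminorm h -> (forall v, v != 0 -> 0 < h v) -> v1 != 0 ->
  exists2 v0, v0 != 0 & forall v, v != 0 -> g v / h v <= g v0 / h v0.
Proof.
move=> sg sh h_gt0 v1_neq0.
pose S := [set v : 'rV[R]_n | `|v| = 1].
have S_neq0 v : S v -> v != 0.
  by rewrite /S/= => v1'; rewrite -normr_eq0 v1' oner_eq0.
have toS v : v != 0 -> S (`|v|^-1 *: v).
  move=> v0; rewrite /S/= normrZ ger0_norm ?invr_ge0// mulVf// normr_eq0//.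
have S0 : S !=set0 by exists (`|v1|^-1 *: v1); exact: toS.
have cS : compact S.
  apply: bounded_closed_compact.
    by exists 1; split => // x x1 v /= ->; exact: ltW.
  rewrite (_ : S = Num.norm @^-1` [set 1]) //.
  by apply: preimage_closed => [v _|]; [exact: norm_continuous|exact: closed_eq].
have cgh : {within S, continuous (fun v => g v / h v)}.
  apply: continuous_in_subspaceT => v /set_mem /S_neq0 /h_gt0 hv.
  have nbv := nbhs_filter v.
  apply: (@cvgM _ _ (nbhs v) nbv g (fun w => (h w)^-1)).
    exact: seminorm_continuous.
  apply: (@cvgV _ _ (nbhs v) nbv h); first exact: lt0r_neq0.
  exact: seminorm_continuous.
have [v0 /set_mem Sv0 v0max] := compact_EVT_max S0 cS cgh.
exists v0; first exact: S_neq0.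
move=> v v_neq0; have := v0max _ (mem_set (toS _ v_neq0)).
rewrite sg.2 sh.2 -mulf_div divff ?mul1r//.
by rewrite normr_eq0 invr_eq0 normr_eq0.
Qed.
End Seminorms.

(** * Real coordinates of complex tensors *)

Section RealCoordinates.
(** The boolean separates the imaginary part ([true]) of an entry from its real
    part ([false]). *)
Definition coord_index (n p : nat) : finType := (('I_p * 'I_n) * 'I_n * bool)%type.

Variables (R : realType) (n p : nat).

Definition of_coords (v : 'rV[R]_#|coord_index n p|) : tensor R n p :=
  [ffun k => \matrix_(i, j) (v 0 (enum_rank ((k, i), j, false)) +i*
                             v 0 (enum_rank ((k, i), j, true)))].

Definition to_coords (C : tensor R n p) : 'rV[R]_#|coord_index n p| :=
  \row_r let: ((k, i), j, b) := enum_val r : coord_index n p in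
    if b then complex.Im (C k i j) else complex.Re (C k i j).

Lemma to_coordsK : cancel to_coords of_coords.
Proof.
move=> C; apply/ffunP => k; apply/matrixP => i j.
by rewrite ffunE !mxE !enum_rankK; case: (C k i j).
Qed.

Lemma of_coordsK : cancel of_coords to_coords.
Proof.
move=> v; apply/rowP => r; rewrite !mxE.
rewrite -[in RHS](enum_valK r).
by case: (enum_val r) => [[[k i] j] []]; rewrite ffunE mxE.
Qed.

Lemma of_coordsD u v : of_coords (u + v) = of_coords u + of_coords v.
Proof.
by apply/ffunP => k; apply/matrixP => i j; rewrite !ffunE !mxE.
Qed.

Lemma of_coordsZ (a : R) v : of_coords (a *: v) = a%:C *: of_coords v.
Proof.
apply/ffunP => k; apply/matrixP => i j; rewrite !ffunE !mxE.
by apply/eqP; rewrite eq_complex /= !mul0r subr0 addr0 !eqxx.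
Qed.

End RealCoordinates.

(** * The maximal gain of a linear map *)

(** Pulled back along [of_coords], which is real-linear and bijective, the two
    norms in the quotient fall under [seminorm_ratio_max]. *)
Lemma linear_gain_max (R : realType) (n p : nat)
    (L : {linear tensor R n.+1 p.+1 -> tensor R n.+1 p.+1}) :
  exists2 C0, C0 != 0 & forall C, C != 0 ->
    tnorm (L C) / tnorm C <= tnorm (L C0) / tnorm C0.
Proof.
pose h v := tnorm (@of_coords R n.+1 p.+1 v).
pose g v := tnorm (L (@of_coords R n.+1 p.+1 v)).
have of_coords_neq0 v : v != 0 -> @of_coords R n.+1 p.+1 v != 0.
  apply: contraNneq => v0; rewrite -(of_coordsK v) v0.
  by apply/eqP/rowP => r; rewrite !mxE; case: (enum_val r) => [[[k i] j] []];
    rewrite ffunE mxE.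
have sg : seminorm g.
  split => [u v|a v]; rewrite /g.
    by rewrite of_coordsD linearD; exact: tnormD.
  by rewrite of_coordsZ linearZ; exact: tnormZ.
have sh : seminorm h.
  split => [u v|a v]; rewrite /h.
    by rewrite of_coordsD; exact: tnormD.
  by rewrite of_coordsZ; exact: tnormZ.
have h0 v : v != 0 -> 0 < h v.
  by move=> v0; rewrite tnorm_gt0 of_coords_neq0.
pose r0 := enum_rank (((ord0, ord0), ord0, true) : coord_index n.+1 p.+1).
have v1_neq0 : delta_mx 0 r0 != 0 :> 'rV[R]_#|coord_index n.+1 p.+1|.
  by apply/eqP => /rowP/(_ r0) /eqP; rewrite !mxE !eqxx oner_eq0.
have [v0 v0_neq0 v0max] := seminorm_ratio_max sg sh h0 v1_neq0.
exists (of_coords v0); first exact: of_coords_neq0.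
move=> C C0; rewrite -(to_coordsK C); apply: v0max.
apply: contraNneq C0 => vC; rewrite -(to_coordsK C) vC.
by apply/eqP; rewrite -(scale0r 0) of_coordsZ scale0r.
Qed.

Section OperatorNorm.
Variables (R : realType) (n p : nat).
Local Notation T := (tensor R n.+1 p.+1).
Variable L : {linear T -> T}.

Lemma opnorm_max : gains L (opnorm L) /\ ubound (gains L) (opnorm L).
Proof.
have [C0 C0_neq0 C0max] := linear_gain_max L.
have ub : ubound (gains L) (tnorm (L C0) / tnorm C0).
  by move=> _ [C /C0max ? <-].
have g0 : gains L (tnorm (L C0) / tnorm C0) by exists C0.
suff -> : opnorm L = tnorm (L C0) / tnorm C0 by [].
apply/le_anti/andP; split; first by apply: ge_sup => //; eexists; exact: g0.
by apply: ub_le_sup => //; eexists; exact: ub.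
Qed.

Lemma opnorm_ge0 : 0 <= opnorm L.
Proof.
by have [[C _ <-] _] := opnorm_max; rewrite divr_ge0// tnorm_ge0.
Qed.

Lemma opnorm_bound C : tnorm (L C) <= opnorm L * tnorm C.
Proof.
have [->|C0] := eqVneq C 0; first by rewrite linear0 tnorm0 mulr0.
by rewrite -ler_pdivrMr ?tnorm_gt0//; apply: opnorm_max.2; exists C.
Qed.

(** * The limit of the difference quotients *)

(** The supremum is squeezed between [(M - eta) * s / d] and
    [(M + eta) * s / d], the error of the linear approximation being at most
    [eta * tnorm C] on the ball. Allowing [s = 0] covers the relative condition
    number at the zero tensor, where the ball is reduced to [0]. *)
Lemma quotient_cvg (G : T -> T) (s d : R) : 0 <= s -> 0 < d ->
  (forall e : R, 0 < e -> exists2 r : R, 0 < r & forall C, tnorm C <= r ->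
     tnorm (G C - L C) <= e * tnorm C) ->
  ereal_sup [set (tnorm (G C) / (e * d))%:E | C in [set C | tnorm C <= e * s]]
    @[e --> 0^'+] --> (opnorm L * s / d)%:E.
Proof.
move=> s0 d0 GL; set M := opnorm L.
pose F (e : R) := ereal_sup
  [set (tnorm (G C) / (e * d))%:E | C in [set C | tnorm C <= e * s]].
have sandwich (eta : R) : 0 < eta -> \forall e \near 0^'+,
    (((M - eta) * s / d)%:E <= F e <= ((M + eta) * s / d)%:E)%E.
  move=> eta0; have [r r0 Gr] := GL _ eta0.
  (* e <= r / (s + 1) forces e * s <= r, also when s = 0. *)
  have rs0 : 0 < r / (s + 1) by rewrite divr_gt0// ltr_wpDl.
  near=> e.
  have e0 : 0 < e by near: e; exact: nbhs_right_gt.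
  have er : e * s <= r.
    have : e <= r / (s + 1) by near: e; exact: nbhs_right_le.
    rewrite ler_pdivlMr ?ltr_wpDl// mulrDr mulr1 => es.
    by rewrite (le_trans _ es)// lerDl ltW.
  have quot x y : (x / (e * d) <= y * s / d) = (x <= y * (e * s)).
    rewrite ler_pdivrMr ?mulr_gt0// (_ : y * s / d * _ = y * (e * s))//.
    by field; rewrite gt_eqF.
  have quotV x y : (y * s / d <= x / (e * d)) = (y * (e * s) <= x).
    rewrite ler_pdivlMr ?mulr_gt0// (_ : y * s / d * _ = y * (e * s))//.
    by field; rewrite gt_eqF.
  apply/andP; split.
    have [[C1 C1_neq0 C1M] _] := opnorm_max.
    (* A maximizer of the gain, rescaled onto the boundary of the ball. *)
    pose C := (e * s / tnorm C1)%:C *: C1.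
    have C1_gt0 : 0 < tnorm C1 by rewrite tnorm_gt0.
    have es0 : 0 <= e * s by rewrite mulr_ge0// ltW.
    have nC : tnorm C = e * s.
      by rewrite tnormZ ger0_norm ?divr_ge0 ?tnorm_ge0// divfK// gt_eqF.
    have nLC : tnorm (L C) = M * (e * s).
      rewrite /C linearZ /= tnormZ ger0_norm ?divr_ge0 ?tnorm_ge0//.
      by rewrite /M -C1M; field; rewrite gt_eqF.
    apply: (@le_trans _ _ (tnorm (G C) / (e * d))%:E); last first.
      by apply: ereal_sup_ubound; exists C => //=; rewrite nC.
    rewrite lee_fin quotV mulrBl -nLC.
    have := tnormD (L C - G C) (G C); have := Gr C; rewrite nC => /(_ er).
    rewrite subrK -tnormN opprB; lra.
  apply: ge_ereal_sup => _ [C /= Ces <-].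
  rewrite lee_fin quot.
  have : (M + eta) * tnorm C <= (M + eta) * (e * s).
    by rewrite ler_wpM2l// addr_ge0 ?opnorm_ge0// ltW.
  apply: le_trans; rewrite mulrDl addrC.
  apply: le_trans (lerD (Gr _ (le_trans Ces er)) (opnorm_bound C)).
  by have := tnormD (G C - L C) (L C); rewrite subrK.
have fin (x y : R) z : (x%:E <= z <= y%:E)%E -> z \is a fin_num.
  case/andP => lo up; rewrite fin_numElt.
  by rewrite (lt_le_trans (ltNyr _) lo) (le_lt_trans up (ltry _)).
apply/fine_cvgP; split.
  by near=> e; apply: fin; near: e; exact: (sandwich 1).
apply/cvgrPdist_le => e e0.
(* Chosen so that eta * s / d <= e, also when s = 0. *)
pose eta := e * d / (s + 1).
have eta0 : 0 < eta by rewrite divr_gt0 ?mulr_gt0// ltr_wpDl.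
have eta_le : eta * s / d <= e.
  rewrite (_ : _ / d = e * (s / (s + 1))).
    by rewrite ler_piMr ?(ltW e0)// ler_pdivrMr ?mul1r ?lerDl ?ltr_wpDl.
  by rewrite /eta; field; rewrite !gt_eqF// ltr_wpDl.
near=> t.
have Ft : (((M - eta) * s / d)%:E <= F t <= ((M + eta) * s / d)%:E)%E.
  by near: t; exact: sandwich.
move: (Ft); rewrite -(fineK (fin _ _ _ Ft)) !lee_fin => /andP[].
by rewrite /= -/(F t) !mulrDl !mulNr ler_norml; lra.
Unshelve. all: by end_near. Qed.

End OperatorNorm.

Theorem lemma5 (R : realType) (n p : nat) (D : set R[i]) (f : R[i] -> R[i])
    (A : tensor R n.+1 p.+1)
    (L : {linear tensor R n.+1 p.+1 -> tensor R n.+1 p.+1})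
    (hL : is_frechet D f A L) :
  [/\ gains L (opnorm L) /\ ubound (gains L) (opnorm L),
      cvg (abs_quotient f A e @[e --> 0^'+]) /\
      cond_abs f A = (opnorm L)%:E
    & tfun f A != 0 ->
      cvg (rel_quotient f A e @[e --> 0^'+]) /\
      cond_rel f A = (opnorm L * tnorm A / tnorm (tfun f A))%:E].
Proof.
have [_ dL] := hL.
have cvg_abs : abs_quotient f A e @[e --> 0^'+] --> (opnorm L)%:E.
  have -> : abs_quotient f A = fun e => ereal_sup
      [set (tnorm (tfun f (A + C) - tfun f A) / (e * 1))%:E
      | C in [set C | tnorm C <= e * 1]].
    by apply/funext => e; rewrite mulr1.
  by have := quotient_cvg ler01 ltr01 dL; rewrite mulr1 divr1.
split; first exact: opnorm_max.
  split; first by apply/cvg_ex; exists (opnorm L)%:E.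
  exact: cvg_lim.
move=> fA0; have cvg_rel : rel_quotient f A e @[e --> 0^'+] -->
    (opnorm L * tnorm A / tnorm (tfun f A))%:E.
  by apply: quotient_cvg; rewrite ?tnorm_ge0 ?tnorm_gt0.
split; first by apply/cvg_ex; exists (opnorm L * tnorm A / tnorm (tfun f A))%:E.
exact: cvg_lim.
Qed.
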